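(* Let $n>1$ be an odd integer, let $r\geqslant 1$, and let $d\in\{1,2\}$. Then, modulo \[ [n^r]\prod_{j=0}^{(n^{r-1}-1)/d}(1-aq^{(2j+1)n})(a-q^{(2j+1)n}), \] we have \[ \sum_{k=0}^{(n^r-1)/d} q^{k^2}[6k+1]\frac{(aq;q^2)_k (q/a;q^2)_k (q^2;q^4)_k }{(aq^4;q^4)_k(q^4/a;q^4)_k(q^4;q^4)_k} \equiv (-q)^{(1-n)/2} [n] \sum_{k=0}^{(n^{r-1}-1)/d} q^{nk^2}[6k+1]_{q^n}\frac{(aq^n;q^{2n})_k (q^n/a;q^{2n})_k (q^{2n};q^{4n})_k }{(aq^{4n};q^{4n})_k(q^{4n}/a;q^{4n})_k(q^{4n};q^{4n})_k}. \]
   Context: Here $a$ is an indeterminate and both sides are rational functions in $q$ and $a$. Notation: $(x;q)_k=(1-x)(1-xq)\cdots(1-xq^{k-1})$ (with $(x;q)_0=1$) is the $q$-shifted factorial; $[m]=[m]_q=1+q+\cdots+q^{m-1}$ is the $q$-integer, and $[m]_{q^n}=1+q^n+\cdots+q^{n(m-1)}$. For rational functions $A,B$ in $q,a$ and a polynomial $P$ in $q,a$, $A\equiv B\pmod{P}$ means that $A-B$ can be written as a quotient of polynomials whose numerator is divisible by $P$ and whose denominator is relatively prime to $P$. *)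

(* Defs.v *)
From HB Require Import structures.
From mathcomp Require Import all_boot all_order all_algebra fraction.
Set Implicit Arguments. Unset Strict Implicit. Unset Printing Implicit Defensive.
Import Order.TTheory GRing.Theory Num.Theory.
Local Open Scope ring_scope.

Definition bipoly := {poly {poly rat}}.
Definition ratfun := {fraction bipoly}.

Definition tofr (p : bipoly) : ratfun := @FracField.tofrac bipoly p.

Definition qP : bipoly := ('X : {poly rat})%:P.
Definition aP : bipoly := 'X.
Definition qF : ratfun := tofr qP.
Definition aF : ratfun := tofr aP.

Definition qpoch {T : ringType} (x b : T) (k : nat) : T :=
  \prod_(i < k) (1 - x * b ^+ i).

Definition qint {T : ringType} (m : nat) (b : T) : T := \sum_(i < m) b ^+ i.

Definition pdvd (c x : bipoly) : Prop := exists e : bipoly, x = e * c.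

Definition rel_prime (x y : bipoly) : Prop :=
  forall c : bipoly, pdvd c x -> pdvd c y -> c \is a GRing.unit.

Definition qcong (A B : ratfun) (P : bipoly) : Prop :=
  exists N D : bipoly, D != 0 /\ A - B = tofr N / tofr D /\ pdvd P N /\ rel_prime D P.

(* Main.v *)
Require Import Defs.
From HB Require Import structures.
From mathcomp Require Import all_boot all_order all_algebra fraction.
From mathcomp Require Import algC cyclotomic.
From mathcomp Require Import ring zify.
Import Order.TTheory GRing.Theory Num.Theory.
Local Open Scope ring_scope.

(** Write S(a) for the sum on the left.  A single telescoping relation (a
    q-Zeilberger certificate) links S(a) and S(a q^4) whenever the boundary term
    vanishes: (a q^4 - 1) S(a) = q^2 (a - 1) S(a q^4).
    For a = q^(-N) with N odd the sum terminates and the relation gives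
    S(q^(-N)) = (-q)^((1-N)/2) [N]; since S(a) = S(1/a) and [(2j+1)n] =
    [n] [2j+1]_(q^n), both sides of the congruence agree at a = q^(+-(2j+1)n).
    At a primitive m-th root of unity w with m = 2M+1 the sum stops at k = M, and
    after clearing denominators the same relation says that a polynomial P in a of
    degree at most 2M satisfies w^2 P(w^4 a) = P(a).  Hence P is a multiple of a^M,
    and it vanishes at a = w^(-2), so P = 0.  The terms are multiplicative over
    blocks of length m, so the longer sums vanish at every N-th root of unity
    other than 1, which is divisibility by [N].
    Divisibility and coprimality in Q[q][a] are read off from complex values:
    q is specialised to roots of unity or to the integers n >= 2. *)

(** * Gaussian binomials and the summand *)

(** The q-Pascal rule avoids division, so the binomials exist over every ring and keep their meaning
    when [y] is a root of unity. *)
Fixpoint qbin {R : nzRingType} (y : R) (n k : nat) : R :=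
  match n, k with
  | _, 0 => 1
  | 0, _.+1 => 0
  | n'.+1, k'.+1 => qbin y n' k' + y ^+ k'.+1 * qbin y n' k'.+1
  end.

Lemma qbinn0 {R : nzRingType} (y : R) n : qbin y n 0 = 1.
Proof. by case: n. Qed.

Lemma qbin_small {R : nzRingType} (y : R) n k : (n < k)%N -> qbin y n k = 0.
Proof.
elim: n k => [|n IHn] [|k] //= ltnk.
by rewrite !IHn ?mulr0 ?addr0 //; lia.
Qed.

(** The ratio identity in row n gives the absorption identity in row n+1. It is conditional because
    the induction for [qbinS] applies it to its own hypothesis. *)
Lemma qbin_down_step {R : comNzRingType} (y : R) n k :
  (forall i, (1 - y ^+ i.+1) * qbin y n i.+1 = (1 - y ^+ (n - i)) * qbin y n i) ->
  (1 - y ^+ k.+1) * qbin y n.+1 k.+1 = (1 - y ^+ n.+1) * qbin y n k.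
Proof.
move=> E; rewrite /= mulrDr mulrCA E mulrCA.
case: (leqP k n) => [lekn|ltnk]; last by rewrite qbin_small // !mulr0 addr0.
have -> : y ^+ n.+1 = y ^+ k.+1 * y ^+ (n - k) by rewrite -exprD; congr (_ ^+ _); lia.
ring.
Qed.

Lemma qbinS {R : comNzRingType} (y : R) n k :
  (1 - y ^+ k.+1) * qbin y n k.+1 = (1 - y ^+ (n - k)) * qbin y n k.
Proof.
elim: n k => [|n IHn] k; first by case: k => [|k] /=; rewrite expr0 subrr mul0r mulr0.
rewrite qbin_down_step //.
case: k => [|k]; first by rewrite subn0 !qbinn0.
rewrite subSS [qbin y n.+1 k.+1]/= mulrDr -IHn mulrCA.
case: (leqP k n) => [lekn|ltnk]; last by rewrite qbin_small ?mulr0 ?addr0 //; lia.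
have -> : y ^+ n.+1 = y ^+ k.+1 * y ^+ (n - k) by rewrite -exprD; congr (_ ^+ _); lia.
ring.
Qed.

(** The quotient of q-factorials has 1 - y^(2k+2) over (1 - y^(k+1))^2; cancelling one factor leaves
    1 + y^(k+1). *)
Lemma qbin_central {R : comNzRingType} (y : R) k :
  (1 - y ^+ k.+1) * qbin y (2 * k.+1) k.+1 =
  (1 + y ^+ k.+1) * (1 - y ^+ (2 * k + 1)) * qbin y (2 * k) k.
Proof.
have -> : (2 * k.+1 = (2 * k).+2)%N by lia.
have E2 := @qbin_down_step R y (2 * k) k (qbinS y (2 * k)).
rewrite [qbin y (2 * k).+2 k.+1]/= -/(qbin y (2 * k).+1 k).
have := qbinS y (2 * k).+1 k.
have -> : ((2 * k).+1 - k = k.+1)%N by lia.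
rewrite addn1 -/(qbin y (2 * k).+1 k.+1) => E3.
rewrite mulrDr -E3 mulrCA.
move: E2; set b := qbin y (2 * k).+1 k.+1 => E2.
have -> : (1 - y ^+ k.+1) * b + y ^+ k.+1 * ((1 - y ^+ k.+1) * b)
  = (1 + y ^+ k.+1) * ((1 - y ^+ k.+1) * b) by ring.
by rewrite E2 mulrA.
Qed.

Lemma rmorph_qbin {R S : nzRingType} (f : {rmorphism R -> S}) (y : R) n k :
  f (qbin y n k) = qbin (f y) n k.
Proof.
elim: n k => [|n IHn] [|k] /=; rewrite ?rmorph0 ?rmorph1 //.
by rewrite rmorphD rmorphM rmorphXn !IHn.
Qed.

(** Here and in [den_step] the factor containing 1/a is multiplied by a; these powers of a cancel in
    [core]. *)
Definition num_step {R : comNzRingType} (q a : R) (i : nat) : R :=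
  (1 - a * q ^+ (2 * i + 1)) * (a - q ^+ (2 * i + 1)).

(* (q^2;q^4)_k / (q^4;q^4)_k equals the q^4-binomial [2k,k] divided by
   prod_(1 <= i <= 2k) (1 + q^(2i)); in this form it has no pole at roots of unity of
   odd order. *)
Definition den_step {R : comNzRingType} (q a : R) (i : nat) : R :=
  (1 - a * q ^+ (4 * i + 4)) * (a - q ^+ (4 * i + 4))
  * ((1 + q ^+ (4 * i + 2)) * (1 + q ^+ (4 * i + 4))).

Definition coreN {R : comNzRingType} (q a : R) (k : nat) : R :=
  q ^+ (k ^ 2) * qbin (q ^+ 4) (2 * k) k * \prod_(i < k) num_step q a i.

Definition den {R : comNzRingType} (q a : R) (K : nat) : R := \prod_(i < K) den_step q a i.

(** Numerator of the partial sum over the common denominator [den q a K]. As a ring expression it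
    can be specialised even where the quotient has poles. *)
Definition num {R : comNzRingType} (q a : R) (K : nat) : R :=
  \sum_(k < K.+1) qint (6 * k + 1) q * coreN q a k * \prod_(k <= i < K) den_step q a i.

(** Without the factor [6k+1], consecutive values have a ratio that is a product of simple
    factors. *)
Definition core {F : fieldType} (q a : F) k : F := coreN q a k / den q a k.
Definition term {F : fieldType} (q a : F) k : F := qint (6 * k + 1) q * core q a k.

Lemma qintE {R : comNzRingType} (q : R) m : (1 - q) * qint m q = 1 - q ^+ m.
Proof.
rewrite /qint; elim: m => [|m IH]; first by rewrite big_ord0 mulr0 expr0 subrr.
by rewrite big_ord_recr /= mulrDr IH exprS; ring.
Qed.

Lemma den_neq0 {F : fieldType} (q a : F) K :
  (den q a K != 0) <-> (forall i, (i < K)%N -> den_step q a i != 0).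
Proof.
rewrite /den; split=> [/prodf_neq0 H i ltiK|H]; first exact: (H (Ordinal ltiK)).
by apply/prodf_neq0 => i _; apply: H.
Qed.

Lemma num_div {F : fieldType} (q a : F) K : den q a K != 0 ->
  num q a K / den q a K = \sum_(k < K.+1) term q a k.
Proof.
move=> dK; rewrite /num mulr_suml; apply: eq_bigr => k _.
have leK : (k <= K)%N by rewrite -ltnS.
have E : den q a K = den q a k * \prod_(k <= i < K) den_step q a i.
  by rewrite /den -!(big_mkord xpredT) -big_cat_nat.
have := dK; rewrite E mulf_eq0 negb_or => /andP[d1 d2].
rewrite /term /core; field.
by rewrite d1 d2.
Qed.

(* At a root of unity [1 - q ^+ (4 * k + 4)] may vanish, so it is not divided out. *)
Lemma coreS {F : fieldType} (q a : F) k : den_step q a k != 0 ->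
  (1 - q ^+ (4 * k + 4)) * ((1 - a * q ^+ (4 * k + 4)) * (a - q ^+ (4 * k + 4)))
    * core q a k.+1 =
  q ^+ (2 * k + 1) * num_step q a k * (1 - q ^+ (4 * k + 2)) * core q a k.
Proof.
move=> dk; rewrite /core /coreN; have := qbin_central (q ^+ 4) k.
move: (qbin _ (2 * k.+1) k.+1) (qbin _ _ k) => c' c.
rewrite /den !big_ord_recr /= -!exprM.
have -> : (4 * k.+1 = 4 * k + 4)%N by lia.
have -> : (4 * (2 * k + 1) = (4 * k + 2) * 2)%N by lia.
have -> : (k.+1 ^ 2 = k ^ 2 + (2 * k + 1))%N by lia.
set P := \prod_(i < k) num_step _ _ _; set D := \prod_(i < k) den_step _ _ _.
rewrite (exprM _ _ 2) (exprD _ (k ^ 2)); set z := q ^+ (k ^ 2); set n := num_step q a k.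
move: dk; rewrite /den_step; set u := q ^+ (4 * k + 4); set v := q ^+ (4 * k + 2).
set w := q ^+ (2 * k + 1); move=> + Cq.
rewrite !mulf_eq0 !negb_or => /andP[/andP[d1 d2] /andP[d3 d4]].
(* For [D] = 0 both sides vanish, since the inverse of 0 is 0. *)
have [->|D0] := eqVneq D 0; first by rewrite mul0r invr0 !mulr0.
transitivity (((1 - u) * c') * (z * w * (P * n)) / (D * (1 + v) * (1 + u))).
  by field; rewrite D0 d1 d2 d3 d4.
by rewrite Cq; field; rewrite D0 d3 d4.
Qed.

Lemma core0 {F : fieldType} (q a : F) : core q a 0 = 1.
Proof. by rewrite /core /coreN /den !big_ord0 /= !mulr1 invr1 mulr1. Qed.

(** * The telescoping relation *)

(** Passing to a q^4 changes (aq;q^2)_k and (q/a;q^2)_k by two factors at each end, and (aq^4;q^4)_k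
    and (q^4/a;q^4)_k by one, so the ratio of the cores is rational in a, q and q^k. *)
Lemma core_shift {F : fieldType} (q a : F) k :
    a - 1 != 0 ->
    (forall i, (i < k)%N -> a * q - q ^+ (2 * i) != 0) ->
    (forall i, (i < k)%N -> a * q ^+ 3 - q ^+ (2 * i) != 0) ->
    (forall i, (i < k)%N -> 1 - q ^+ (4 * i + 4) != 0) ->
    (forall i, (i < k)%N -> den_step q a i != 0) ->
    (forall i, (i < k)%N -> den_step q (a * q ^+ 4) i != 0) ->
  (a * q ^+ 3 - q ^+ (2 * k)) * (a * q - q ^+ (2 * k)) * (1 - a * q ^+ (4 * k + 4))
    * (a - 1) * core q (a * q ^+ 4) k =
  (1 - a * q ^+ (2 * k + 1)) * (1 - a * q ^+ (2 * k + 3)) * (1 - a * q ^+ 4)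
    * (a - q ^+ (4 * k)) * core q a k.
Proof.
move=> a1; elim: k => [|k IH] h1 h3 hq hd hd'.
  by rewrite !core0 !muln0 !expr0 !add0n expr1; ring.
have {}IH := IH (fun i l => h1 i (leqW l)) (fun i l => h3 i (leqW l))
  (fun i l => hq i (leqW l)) (fun i l => hd i (leqW l)) (fun i l => hd' i (leqW l)).
have E1 := coreS _ _ _ (hd k (leqnn _)); have E2 := coreS _ _ _ (hd' k (leqnn _)).
have k1 := h1 k (leqnn _); have k3 := h3 k (leqnn _); have kq := hq k (leqnn _).
have := hd k (leqnn _); have := hd' k (leqnn _); rewrite /den_step.
move: E1 E2 IH k1 k3 kq; rewrite /num_step.
(* All powers of q are written through x = q^k; once every core is expressed by [s], a rational
   identity in a, q and x remains. *)
have e m c : q ^+ (m * k + c) = (q ^+ k) ^+ m * q ^+ c by rewrite exprD mulnC exprM.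
have e0 m : q ^+ (m * k) = (q ^+ k) ^+ m by rewrite mulnC exprM.
have -> : (2 * k.+1 = 2 * k + 2)%N by lia.
have -> : (4 * k.+1 = 4 * k + 4)%N by lia.
have -> : (4 * k + 4 + 4 = 4 * k + 8)%N by lia.
have -> : (2 * k + 2 + 1 = 2 * k + 3)%N by lia.
have -> : (2 * k + 2 + 3 = 2 * k + 5)%N by lia.
rewrite !e !e0; set x := q ^+ k.
set s := core q a k; set s' := core q (a * q ^+ 4) k.
set t := core q a k.+1; set t' := core q (a * q ^+ 4) k.+1.
move=> E1 E2 IH k1 k3 kq.
rewrite !mulf_eq0 !negb_or -!andbA => /and4P[d1' d2' _ _] /and4P[d1 d2 _ _].
have Es : s' = (1 - a * (x ^+ 2 * q ^+ 1)) * (1 - a * (x ^+ 2 * q ^+ 3)) * (1 - a * q ^+ 4)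
    * (a - x ^+ 4) * s / ((a * q ^+ 3 - x ^+ 2) * (a * q - x ^+ 2)
    * (1 - a * (x ^+ 4 * q ^+ 4)) * (a - 1)).
  by rewrite -IH; field; rewrite ?exprMn a1 d1 k1 k3.
have Et : t = x ^+ 2 * q ^+ 1 *
     ((1 - a * (x ^+ 2 * q ^+ 1)) * (a - x ^+ 2 * q ^+ 1)) *
     (1 - x ^+ 4 * q ^+ 2) * s / ((1 - x ^+ 4 * q ^+ 4) *
     ((1 - a * (x ^+ 4 * q ^+ 4)) * (a - x ^+ 4 * q ^+ 4))).
  by rewrite -E1; field; rewrite ?exprMn d1 d2 kq.
have Et' : t' = x ^+ 2 * q ^+ 1 *
     ((1 - a * q ^+ 4 * (x ^+ 2 * q ^+ 1)) *
      (a * q ^+ 4 - x ^+ 2 * q ^+ 1)) * (1 - x ^+ 4 * q ^+ 2) * s' / ((1 - x ^+ 4 * q ^+ 4) *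
     ((1 - a * q ^+ 4 * (x ^+ 4 * q ^+ 4)) *
      (a * q ^+ 4 - x ^+ 4 * q ^+ 4))).
  by rewrite -E2; field; rewrite ?exprMn d1' d2' kq.
rewrite Et' Es Et; field; rewrite ?exprMn.
by rewrite d2 d1 kq d2' d1' a1 k1 k3.
Qed.

(* A q-Zeilberger certificate for [term]; its factor 1 - q^(4k) kills the term at k = 0. *)
Definition cert {F : fieldType} (q a : F) k : F :=
  q * (1 - a * q ^+ 4) * (1 + a * q ^+ 2) * (q - q ^+ (2 * k)) * (1 - q ^+ (4 * k))
  * (a - q ^+ (4 * k)) / ((a * q - q ^+ (2 * k)) * (a * q ^+ 3 - q ^+ (2 * k))).

(** Induction on k: by [coreS] and [core_shift] the new terms and the new boundary value are
    multiples of [core q a k]. The factor 1 - q turns [6k+1] into 1 - q^(6k+1). *)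
Lemma telescope {F : fieldType} (q a : F) k :
    a - 1 != 0 ->
    (forall i, (i <= k)%N -> a * q - q ^+ (2 * i) != 0) ->
    (forall i, (i <= k)%N -> a * q ^+ 3 - q ^+ (2 * i) != 0) ->
    (forall i, (i < k)%N -> 1 - q ^+ (4 * i + 4) != 0) ->
    (forall i, (i < k)%N -> den_step q a i != 0) ->
    (forall i, (i < k)%N -> den_step q (a * q ^+ 4) i != 0) ->
  (1 - q) * ((a * q ^+ 4 - 1) * \sum_(i < k) term q a i
      - q ^+ 2 * (a - 1) * \sum_(i < k) term q (a * q ^+ 4) i)
  = cert q a k * core q a k.
Proof.
move=> a1; elim: k => [|k IH] h1 h3 hq hd hd'.
  by rewrite !big_ord0 /cert !muln0 expr0 subrr !(mulr0, mul0r) subrr mulr0.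
have {}IH := IH (fun i l => h1 i (leqW l)) (fun i l => h3 i (leqW l))
  (fun i l => hq i (leqW l)) (fun i l => hd i (leqW l)) (fun i l => hd' i (leqW l)).
have E1 := coreS _ _ _ (hd k (leqnn _)).
have E2 := core_shift _ _ _ a1 (fun i l => h1 i (leqW (ltnW l))) (fun i l => h3 i (leqW (ltnW l)))
  (fun i l => hq i (leqW l)) (fun i l => hd i (leqW l)) (fun i l => hd' i (leqW l)).
have k1 := h1 k (leqnSn _); have k3 := h3 k (leqnSn _); have kq := hq k (leqnn _).
have k1' := h1 k.+1 (leqnn _); have k3' := h3 k.+1 (leqnn _).
rewrite !big_ord_recr /=; move: IH.
set S1 := \sum_(i < k) _; set S2 := \sum_(i < k) _ => IH.
transitivity ((1 - q) * ((a * q ^+ 4 - 1) * S1 - q ^+ 2 * (a - 1) * S2)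
  + ((a * q ^+ 4 - 1) * ((1 - q) * qint (6 * k + 1) q * core q a k)
  - q ^+ 2 * (a - 1) * ((1 - q) * qint (6 * k + 1) q * core q (a * q ^+ 4) k))).
  by rewrite /term; ring.
rewrite IH qintE /cert.
have := hd k (leqnn _); move: E1 E2 k1 k3 kq k1' k3'; rewrite /num_step /den_step.
have e m c : q ^+ (m * k + c) = (q ^+ k) ^+ m * q ^+ c by rewrite exprD mulnC exprM.
have e0 m : q ^+ (m * k) = (q ^+ k) ^+ m by rewrite mulnC exprM.
have -> : (2 * k.+1 = 2 * k + 2)%N by lia.
have -> : (4 * k.+1 = 4 * k + 4)%N by lia.
rewrite !e !e0; set x := q ^+ k.
set s := core q a k; set s' := core q (a * q ^+ 4) k.
set t := core q a k.+1.
move=> E1 E2 k1 k3 kq k1' k3'.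
rewrite !mulf_eq0 !negb_or -!andbA => /and4P[d1 d2 _ _].
have Es : s' = (1 - a * (x ^+ 2 * q ^+ 1)) * (1 - a * (x ^+ 2 * q ^+ 3)) * (1 - a * q ^+ 4)
    * (a - x ^+ 4) * s / ((a * q ^+ 3 - x ^+ 2) * (a * q - x ^+ 2)
    * (1 - a * (x ^+ 4 * q ^+ 4)) * (a - 1)).
  by rewrite -E2; field; rewrite ?exprMn a1 d1 k1 k3.
have Et : t = x ^+ 2 * q ^+ 1 *
     ((1 - a * (x ^+ 2 * q ^+ 1)) * (a - x ^+ 2 * q ^+ 1)) *
     (1 - x ^+ 4 * q ^+ 2) * s / ((1 - x ^+ 4 * q ^+ 4) *
     ((1 - a * (x ^+ 4 * q ^+ 4)) * (a - x ^+ 4 * q ^+ 4))).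
  by rewrite -E1; field; rewrite ?exprMn d1 d2 kq.
rewrite Es Et; field; rewrite ?exprMn.
by rewrite d2 d1 kq k3' k1' a1 k1 k3.
Qed.

Lemma den_step_invr {F : fieldType} (q a : F) i : a != 0 ->
  den_step q a^-1 i = a ^- 2 * den_step q a i.
Proof. by move=> a0; rewrite /den_step; field. Qed.

(** Each [num_step] and each [den_step] is multiplied by a^(-2), and there are k of both. *)
Lemma term_invr {F : fieldType} (q a : F) k : a != 0 -> term q a^-1 k = term q a k.
Proof.
move=> a0; rewrite /term /core /coreN /den; congr (_ * _).
have -> : \prod_(i < k) num_step q a^-1 i = (a ^- 2) ^+ k * \prod_(i < k) num_step q a i.
  rewrite -[in (a ^- 2) ^+ k](card_ord k) -prodr_const -big_split; apply: eq_bigr => i _ /=.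
  by rewrite /num_step; field.
have -> : \prod_(i < k) den_step q a^-1 i = (a ^- 2) ^+ k * \prod_(i < k) den_step q a i.
  rewrite -[in (a ^- 2) ^+ k](card_ord k) -prodr_const -big_split; apply: eq_bigr => i _ /=.
  by rewrite den_step_invr.
set P := \prod_(i < k) num_step _ _ _; set D := \prod_(i < k) den_step _ _ _.
have : (a ^- 2) ^+ k != 0 by rewrite expf_neq0 // invr_eq0 expf_neq0.
move: ((a ^- 2) ^+ k) => u u0.
have [->|D0] := eqVneq D 0; first by rewrite mulr0 invr0 !mulr0.
by field; rewrite u0 D0.
Qed.

(** The boundary term vanishes in two situations: for terminating sums, and past the middle of a
    period at a root of unity. *)
Lemma sum_term_shift {F : fieldType} (q a : F) k :
    a - 1 != 0 -> q != 1 ->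
    (forall i, (i <= k)%N -> a * q - q ^+ (2 * i) != 0) ->
    (forall i, (i <= k)%N -> a * q ^+ 3 - q ^+ (2 * i) != 0) ->
    (forall i, (i < k)%N -> 1 - q ^+ (4 * i + 4) != 0) ->
    (forall i, (i < k)%N -> den_step q a i != 0) ->
    (forall i, (i < k)%N -> den_step q (a * q ^+ 4) i != 0) ->
    core q a k = 0 ->
  (a * q ^+ 4 - 1) * \sum_(i < k) term q a i
  = q ^+ 2 * (a - 1) * \sum_(i < k) term q (a * q ^+ 4) i.
Proof.
move=> a1 q1 h1 h3 hq hd hd' c0.
have /eqP := telescope _ _ _ a1 h1 h3 hq hd hd'.
by rewrite c0 mulr0 mulf_eq0 subr_eq0 eq_sym (negbTE q1) subr_eq0 => /eqP.
Qed.

(** * Closed form at a = q^(-N) with N odd *)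

Section NotRootOfUnity.
Context {F : fieldType} (q : F).
Hypotheses (q0 : q != 0) (hq : forall i, q ^+ i.+1 != 1).

Lemma expr_neq1 i : (0 < i)%N -> q ^+ i != 1.
Proof. by case: i. Qed.

Lemma expr_inj : injective (fun i => q ^+ i).
Proof.
have wl i j : (i <= j)%N -> q ^+ i = q ^+ j -> i = j.
  move=> leij /eqP; rewrite -(subnKC leij) exprD -{1}[q ^+ i]mulr1.
  rewrite (inj_eq (mulfI (expf_neq0 _ q0))) eq_sym.
  by case E: (j - i)%N => [|d]; [lia | rewrite (negbTE (hq d))].
by move=> i j /= e; case/orP: (leq_total i j) => l; [|symmetry]; apply: wl.
Qed.

Lemma expr_neq i j : i != j -> q ^+ i != q ^+ j.
Proof. by apply: contra => /eqP/expr_inj->. Qed.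

Lemma addr1_expr_neq0 i : (0 < i)%N -> 1 + q ^+ i != 0.
Proof.
move=> i0; apply: contra (expr_neq1 (i * 2) _); last lia.
by rewrite addrC addr_eq0 => /eqP e; rewrite exprM e sqrrN expr1n.
Qed.

(** As 4i+4 is even and 2j+1 is odd, a zero factor would make some positive power of q equal to
    1. *)
Lemma den_step_odd_neq0 j i : den_step q (q ^- (2 * j + 1)) i != 0.
Proof.
have u0 : q ^+ (2 * j + 1) != 0 by rewrite expf_neq0.
rewrite /den_step !mulf_neq0 ?addr1_expr_neq0 //; try lia.
  rewrite subr_eq0 eq_sym -(inj_eq (mulfI u0)) mulVKf // mulr1.
  by apply: expr_neq; lia.
rewrite subr_eq0 -(inj_eq (mulfI u0)) mulfV // -exprD eq_sym.
by apply: expr_neq1; lia.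
Qed.

Lemma subV_neq0 i j : (0 < i + j)%N -> q ^- i - q ^+ j != 0.
Proof.
have u0 : q ^+ i != 0 by rewrite expf_neq0.
move=> h; rewrite subr_eq0 -(inj_eq (mulfI u0)) mulfV // -exprD eq_sym.
exact: expr_neq1.
Qed.

(* The exponent 2j+1 = 3 is a second base case: stepping to it from the exponent -1, where
   the sum is also known, would divide by a q^3 - 1 = 0. *)
Lemma sum_term_odd j T : (j < T)%N ->
  \sum_(k < T) term q (q ^- (2 * j + 1)) k = (- q) ^- j * qint (2 * j + 1) q.
Proof.
have core_eq0 i k : (i < k)%N -> core q (q ^- (2 * i + 1)) k = 0.
  move=> ltik; rewrite /core /coreN (bigD1 (Ordinal ltik)) //= /num_step.
  by rewrite mulVf ?expf_neq0 // subrr !(mul0r, mulr0).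
have q1 : q != 1 by rewrite -[q]expr1.
elim/ltn_ind: j => -[|[|j]] IH ltjT.
(* At a = q^(-1) only the term k = 0 survives. *)
- case: T ltjT {IH} => // T _; rewrite big_ord_recl big1 => [|i _].
    rewrite addr0 /term core0 /qint !muln0 !add0n !big_ord1 !expr0.
    by rewrite invr1 !mulr1.
  by rewrite /term core_eq0 ?mulr0.
(* At a = q^(-3) the terms k = 0 and k = 1 survive; the second comes from [coreS]. *)
- case: T ltjT {IH} => // -[//|T] _; rewrite 2!big_ord_recl big1 => [|i _]; last first.
    by rewrite /term core_eq0 ?mulr0.
  have d0 := den_step_odd_neq0 1 0.
  have := coreS _ _ 0 d0; move: d0.
  rewrite addr0 /term core0 mulr1 /bump /= !muln0 !add0n /num_step /den_step.
  set c := core _ _ _ => d0 E.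
  have q4 : 1 - q ^+ 4 != 0 by rewrite subr_eq0 eq_sym hq.
  move: d0; rewrite !mulf_eq0 !negb_or -!andbA => /and4P[d1 d2 _ _].
  rewrite muln1 addn1.
  apply: (@mulfI _ (1 - q)); first by rewrite subr_eq0 eq_sym.
  have -> : c = q ^+ 1 * ((1 - q ^- (2 * 1 + 1) * q ^+ 1) * (q ^- (2 * 1 + 1) - q ^+ 1))
     * (1 - q ^+ 2) / ((1 - q ^+ 4) *
     ((1 - q ^- (2 * 1 + 1) * q ^+ 4) * (q ^- (2 * 1 + 1) - q ^+ 4))).
    by apply: canRL (mulfK _) _; rewrite ?mulf_neq0 // mulrC.
  rewrite mulrDr [in X in _ + X]mulrA [in RHS]mulrCA !qintE /bump /= /qint big_ord1.
  have -> : (6 * (1 + 0)).+1 = 7%N by [].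
  have q7 : 1 - q ^+ 7 != 0 by rewrite subr_eq0 eq_sym hq.
  have q1' : 1 - q != 0 by rewrite subr_eq0 eq_sym.
  move: d1 d2; rewrite !muln1 !muln0 !add0n.
  have -> : 1 - q ^- (2 + 1) * q ^+ 4 = 1 - q by field.
  have -> : q ^- (2 + 1) - q ^+ 4 = (1 - q ^+ 7) / q ^+ 3 by field.
  by move=> _ _; field; rewrite oppr_eq0 q0 q1' q4 q7.
(* For a = q^(-(2j+5)) one has a q^4 = q^(-(2j+1)), so the relation carries the value at j to
   j+2. *)
have hT : (j < T)%N by lia.
have {}IH := IH j (leqW (leqnn _)) hT.
have e : q ^- (2 * j + 1) = q ^- (2 * j.+2 + 1) * q ^+ 4.
  have -> : (2 * j.+2 + 1 = 2 * j + 1 + 4)%N by lia.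
  by rewrite (exprD _ _ 4) invfM mulfVK ?expf_neq0.
have := sum_term_shift q (q ^- (2 * j.+2 + 1)) T.
rewrite -e IH => H.
have d0 : q ^- (2 * j + 1) - 1 != 0.
  by rewrite -[X in _ - X](expr0 q) subV_neq0 //; lia.
apply: (mulfI d0); rewrite H //.
- have -> : (2 * j.+2 + 1 = 2 * j + 1 + 4)%N by lia.
  have u0 : q ^+ (2 * j + 1) != 0 by rewrite expf_neq0.
  have q1' : 1 - q != 0 by rewrite subr_eq0 eq_sym.
  have qi m : qint m q = (1 - q ^+ m) / (1 - q) by rewrite -qintE mulrC mulKf.
  have p0 : (- q) ^+ j != 0 by rewrite expf_neq0 // oppr_eq0.
  have -> : j.+2 = (j + 2)%N by lia.
  rewrite !qi (exprD _ (2 * j + 1)) (exprD _ j); move: u0 p0.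
  move: (q ^+ (2 * j + 1)) ((- q) ^+ j) => u p u0 p0.
  by field; rewrite oppr_eq0 u0 p0 q0 q1'.
- by rewrite -[X in _ - X](expr0 q) subV_neq0 //; lia.
- move=> i _.
  have -> : (2 * j.+2 + 1 = 2 * j.+2 + 0 + 1)%N by lia.
  by rewrite (exprD _ _ 1) expr1 invfM mulfVK // subV_neq0 //; lia.
- move=> i _.
  have -> : (2 * j.+2 + 1 = 2 * j.+1 + 3)%N by lia.
  by rewrite (exprD _ _ 3) invfM mulfVK ?expf_neq0 // subV_neq0 //; lia.
- by move=> i _; rewrite subr_eq0 eq_sym expr_neq1 //; lia.
- by move=> i _; apply: den_step_odd_neq0.
- by move=> i _; apply: den_step_odd_neq0.
by apply: core_eq0.
Qed.
End NotRootOfUnity.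

(** * Vanishing at roots of unity *)

Lemma rmorph_qint {R S : nzRingType} (f : {rmorphism R -> S}) m q :
  f (qint m q) = qint m (f q).
Proof. by rewrite /qint rmorph_sum; apply: eq_bigr => i _; rewrite rmorphXn. Qed.

Lemma rmorph_num_step {R S : comNzRingType} (f : {rmorphism R -> S}) q a i :
  f (num_step q a i) = num_step (f q) (f a) i.
Proof. by rewrite /num_step !(rmorphM, rmorphB, rmorph1, rmorphXn). Qed.

Lemma rmorph_den_step {R S : comNzRingType} (f : {rmorphism R -> S}) q a i :
  f (den_step q a i) = den_step (f q) (f a) i.
Proof. by rewrite /den_step !(rmorphM, rmorphB, rmorphD, rmorph1, rmorphXn). Qed.

Lemma rmorph_den {R S : comNzRingType} (f : {rmorphism R -> S}) q a K :
  f (den q a K) = den (f q) (f a) K.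
Proof. by rewrite /den rmorph_prod; apply: eq_bigr => i _; rewrite rmorph_den_step. Qed.

Lemma rmorph_num {R S : comNzRingType} (f : {rmorphism R -> S}) q a K :
  f (num q a K) = num (f q) (f a) K.
Proof.
rewrite /num rmorph_sum; apply: eq_bigr => k _.
rewrite /coreN !rmorphM rmorph_qint rmorphXn rmorph_qbin rmorphXn !rmorph_prod.
congr (_ * (_ * _) * _); apply: eq_bigr => i _; first exact: rmorph_num_step.
exact: rmorph_den_step.
Qed.

(** Passing to a q^4 shifts the factors 1 - a q^(4i+4) up and, up to q^4, the factors a - q^(4i+4)
    down by one index, so only the end factors change. *)
Lemma den_shift {R : comNzRingType} (q a : R) K :
  den q (a * q ^+ 4) K * ((1 - a * q ^+ 4) * (a - q ^+ (4 * K))) =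
  den q a K * ((1 - a * q ^+ (4 * K + 4)) * q ^+ (4 * K) * (a - 1)).
Proof.
elim: K => [|K IH]; first by rewrite /den !big_ord0 muln0 add0n expr0; ring.
rewrite /den !big_ord_recr /= -/(den q a K) -/(den q (a * q ^+ 4) K) /den_step.
have -> : (4 * K.+1 = 4 * K + 4)%N by lia.
move: IH; rewrite (exprD _ (4 * K + 4)) !(exprD _ (4 * K)); set x := q ^+ (4 * K) => IH.
transitivity (den q (a * q ^+ 4) K * ((1 - a * q ^+ 4) * (a - x)) *
  ((1 - a * (x * q ^+ 4 * q ^+ 4)) * q ^+ 4 * (a - x * q ^+ 4) *
   ((1 + x * q ^+ 2) * (1 + x * q ^+ 4)))); first ring.
by rewrite IH; ring.
Qed.

(** Such a polynomial has infinitely many roots. The points n >= 2 are used because none of them is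
    0 or a root of unity. *)
Lemma poly_nat_eq0 {R : numDomainType} (p : {poly R}) :
  (forall n : nat, (1 < n)%N -> p.[n%:R] = 0) -> p = 0.
Proof.
move=> h; pose s := [seq n%:R : R | n <- iota 2 (size p)].
apply: (@roots_geq_poly_eq0 _ p s); last by rewrite size_map size_iota.
- by apply/allP => x /mapP[n]; rewrite mem_iota => /andP[n2 _] ->; apply/eqP/h.
- by rewrite map_inj_uniq ?iota_uniq // => x y /eqP; rewrite eqr_nat => /eqP.
Qed.

Lemma size_prod_leq2 {R : nzRingType} (r : seq nat) (f : nat -> {poly R}) :
  (forall i, (size (f i) <= 3)%N) -> (size (\prod_(i <- r) f i)%R <= (2 * size r).+1)%N.
Proof.
move=> h; elim: r => [|i r IH]; first by rewrite big_nil size_poly1.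
rewrite big_cons [size (_ :: _)]/=; apply: leq_trans (size_polyMleq _ _) _.
by have := h i; lia.
Qed.

Lemma num_horner {R : comNzRingType} (q a : R) K : (num q%:P 'X K).[a] = num q a K.
Proof.
rewrite -[LHS]/(horner_eval a _) (rmorph_num (horner_eval a)).
by congr num; [exact: hornerC | exact: hornerX].
Qed.

(** Otherwise z^i = -1, whose N-th power is -1 for odd N. *)
Lemma unity_addr1_neq0 N (z : algC) i : odd N -> z ^+ N = 1 -> 1 + z ^+ i != 0.
Proof.
move=> oddN zN; apply/eqP => /eqP; rewrite addrC addr_eq0 => /eqP e.
have : z ^+ i ^+ N = 1 by rewrite exprAC zN expr1n.
rewrite e -signr_odd oddN expr1 => /eqP.
by rewrite eq_sym -addr_eq0 -(natrD _ 1 1) pnatr_eq0.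
Qed.

Section RootOfUnity.
Variables (M : nat) (w : algC).
Hypotheses (M_gt0 : (0 < M)%N) (w_prim : (2 * M + 1).-primitive_root w).

Let odd_order : odd (2 * M + 1). Proof. by lia. Qed.

Lemma prim_expr_eq1 i : (w ^+ i == 1) = (2 * M + 1 %| i)%N.
Proof. by rewrite -(prim_order_dvd w_prim). Qed.

Lemma prim_expr_neq1 i : (0 < i)%N -> (i < 2 * M + 1)%N -> w ^+ (4 * i) != 1.
Proof.
move=> i0 iM; rewrite prim_expr_eq1 Gauss_dvdr ?gtnNdvd //.
by rewrite (coprimeMr _ 2 2) coprimen2 andbb; lia.
Qed.

Lemma prim_expr_period l m k : w ^+ (m * (l * (2 * M + 1) + k)) = w ^+ (m * k).
Proof.
by rewrite mulnDr exprD mulnA mulnC exprM (prim_expr_order w_prim) expr1n mul1r.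
Qed.

Section Generic.
Variable a : algC.
Hypothesis (ha : forall i, a ^+ i.+1 != 1).

Lemma generic_expr i j : a * w ^+ i != w ^+ j.
Proof.
apply: contra (ha (2 * M)) => /eqP e.
have : (a * w ^+ i) ^+ (2 * M + 1) = 1.
  by rewrite e exprAC (prim_expr_order w_prim) expr1n.
by rewrite exprMn exprAC (prim_expr_order w_prim) expr1n mulr1 addn1 => ->.
Qed.

Lemma generic_sub i j : a * w ^+ i - w ^+ j != 0.
Proof. by rewrite subr_eq0 generic_expr. Qed.

Lemma generic_den_step l i : den_step w (a * w ^+ l) i != 0.
Proof.
have addr1_neq0 k := unity_addr1_neq0 _ w k odd_order (prim_expr_order w_prim).
rewrite /den_step -!mulrA -!exprD !mulf_neq0 ?addr1_neq0 ?generic_sub //.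
by rewrite subr_eq0 eq_sym -[X in _ != X](expr0 w) generic_expr.
Qed.

Lemma generic_den_step0 i : den_step w a i != 0.
Proof. by rewrite -[a]mulr1 -[1 in X in den_step _ X _](expr0 w) generic_den_step. Qed.

(** The ratio at k = M contains 1 - w^(4M+2) = 0. The value 0 then propagates as long as the divisor
    1 - w^(4k+4) is nonzero, that is, within the period. *)
Lemma core_gtM k : (M < k < 2 * M + 1)%N -> core w a k = 0.
Proof.
elim: k => [|k IH]; first by rewrite ltn0.
move=> /andP[Mk kM]; have := coreS w a k (generic_den_step0 k).
have hk : 1 - w ^+ (4 * k + 4) != 0.
  have -> : (4 * k + 4 = 4 * k.+1)%N by lia.
  by rewrite subr_eq0 eq_sym prim_expr_neq1.
have := generic_den_step0 k; rewrite /den_step !mulf_eq0 !negb_or -!andbA => /and4P[d1 d2 _ _].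
move=> E; apply: (@mulfI _ ((1 - w ^+ (4 * k + 4)) *
   ((1 - a * w ^+ (4 * k + 4)) * (a - w ^+ (4 * k + 4))))).
  by rewrite !mulf_neq0.
rewrite E mulr0; move: Mk; rewrite leq_eqVlt => /orP[/eqP[<-]|Mk].
  have -> : (4 * M + 2 = (2 * M + 1) * 2)%N by lia.
  by rewrite exprM (prim_expr_order w_prim) expr1n subrr mulr0 mul0r.
by rewrite IH ?mulr0 //; lia.
Qed.

(** The ratio of consecutive cores depends only on k modulo 2M+1. *)
Lemma core_block l k : (k < 2 * M + 1)%N ->
  core w a (l * (2 * M + 1) + k) = core w a (l * (2 * M + 1)) * core w a k.
Proof.
elim: k => [|k IH] kM; first by rewrite addn0 core0 mulr1.
rewrite addnS.
have := coreS w a _ (generic_den_step0 (l * (2 * M + 1) + k)).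
have := coreS w a k (generic_den_step0 k).
have hk : 1 - w ^+ (4 * k + 4) != 0.
  have -> : (4 * k + 4 = 4 * k.+1)%N by lia.
  by rewrite subr_eq0 eq_sym prim_expr_neq1.
have := generic_den_step0 k; rewrite /den_step !mulf_eq0 !negb_or -!andbA => /and4P[d1 d2 _ _].
rewrite /num_step !(exprD w (_ * (_ + _))) !prim_expr_period -!exprD IH; last lia.
move=> E1 E2; apply: (@mulfI _ ((1 - w ^+ (4 * k + 4)) *
   ((1 - a * w ^+ (4 * k + 4)) * (a - w ^+ (4 * k + 4))))).
  by rewrite !mulf_neq0.
by rewrite E2 [in RHS]mulrCA E1 mulrCA.
Qed.

Lemma prim_neq1 : w != 1.
Proof. by rewrite -[w]expr1 prim_expr_eq1 gtnNdvd //; lia. Qed.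

Lemma term_block l k : (k < 2 * M + 1)%N ->
  term w a (l * (2 * M + 1) + k) = core w a (l * (2 * M + 1)) * term w a k.
Proof.
move=> kM; rewrite /term core_block // [RHS]mulrCA; congr (_ * _).
apply: (@mulfI _ (1 - w)); first by rewrite subr_eq0 eq_sym prim_neq1.
by rewrite !qintE !(exprD w (6 * _)) prim_expr_period.
Qed.

(** The sum up to k = M has zero boundary term by [core_gtM]; after clearing denominators with
    [den_shift] all factors containing a cancel. *)
Lemma num_shift : w ^+ 2 * num w (a * w ^+ 4) M = num w a M.
Proof.
have a1 : a - 1 != 0 by rewrite subr_eq0 -[a]expr1 ha.
have a4 : 1 - a * w ^+ 4 != 0.
  by rewrite subr_eq0 eq_sym -[X in _ != X](expr0 w) generic_expr.
have a2 : 1 - a * w ^+ 2 != 0.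
  by rewrite subr_eq0 eq_sym -[X in _ != X](expr0 w) generic_expr.
have H := sum_term_shift w a M.+1 a1 prim_neq1.
have d1 : den w a M != 0 by apply/den_neq0 => i _; apply: generic_den_step0.
have d2 : den w (a * w ^+ 4) M != 0 by apply/den_neq0 => i _; apply: generic_den_step.
rewrite -!num_div // in H.
have e1 : w ^+ (4 * M + 4) = w ^+ 2.
  have -> : (4 * M + 4 = (2 * M + 1) * 2 + 2)%N by lia.
  by rewrite exprD exprM (prim_expr_order w_prim) expr1n mul1r.
have e2 : w ^+ 2 * w ^+ (4 * M) = 1.
  have e : (2 + 4 * M = (2 * M + 1) * 2)%N by lia.
  by rewrite -exprD e exprM (prim_expr_order w_prim) expr1n.
have w0 : w != 0.
  by apply/eqP => w0; move/eqP: e2; rewrite w0 !expr0n mul0r eq_sym oner_eq0.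
have {}H : (a * w ^+ 4 - 1) * (num w a M / den w a M)
   = w ^+ 2 * (a - 1) * (num w (a * w ^+ 4) M / den w (a * w ^+ 4) M).
  apply: H => [i _|i _|i iM|i _|i _|].
  - by rewrite -{1}[w]expr1 generic_sub.
  - exact: generic_sub.
  - have -> : (4 * i + 4 = 4 * i.+1)%N by lia.
    by rewrite subr_eq0 eq_sym prim_expr_neq1 //; lia.
  - exact: generic_den_step0.
  - exact: generic_den_step.
  - by apply: core_gtM; lia.
have := den_shift w a M; rewrite e1.
have -> : w ^+ (4 * M) = w ^- 2 by rewrite -[RHS]mulr1 -e2 mulKf // expf_neq0.
move: H d1 d2; set n := num w a M; set n' := num w _ M.
set d := den w a M; set d' := den w _ M => H d1 d2 D.
have a4' : a * w ^+ 4 - 1 != 0 by rewrite subr_eq0 eq_sym -subr_eq0.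
have a2' : a * w ^+ 2 - 1 != 0 by rewrite subr_eq0 eq_sym -subr_eq0.
(* In [den_shift] the factor 1 - a w^2 equals -w^2 (a - w^(-2)) and cancels against a - w^(-2). *)
have Ed : d' = d * (a - 1) / (a * w ^+ 4 - 1).
  apply: (@mulIf _ ((1 - a * w ^+ 4) * (a - w ^- 2))).
    by rewrite mulf_neq0 // -(inj_eq (mulIf (expf_neq0 2 w0))) mul0r mulrBl mulVf ?expf_neq0.
  by rewrite D; field; rewrite w0.
move: H; rewrite Ed.
have -> : w ^+ 2 * (a - 1) * (n' / (d * (a - 1) / (a * w ^+ 4 - 1))) =
  (a * w ^+ 4 - 1) * (w ^+ 2 * n' / d) by field; rewrite a1 d1 a4'.
by move=> /(mulfI a4') /(mulIf _) ->; rewrite // invr_eq0.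
Qed.

End Generic.

Lemma generic_nat (n : nat) : (1 < n)%N -> forall i, (n%:R : algC) ^+ i.+1 != 1.
Proof.
by move=> n1 i; rewrite -natrX (eqr_nat _ _ 1) -(expn0 n) eqn_exp2l.
Qed.

(** The k-th summand has k factors [num_step] and M - k factors [den_step], each of degree at most 2
    in a. *)
Lemma size_num : (size (num w%:P 'X M) <= 2 * M + 1)%N.
Proof.
have h2 (c : algC) : (size (1 - 'X * c%:P : {poly algC})%R <= 2)%N.
  rewrite mulrC mul_polyC (leq_trans (size_polyD _ _)) // size_poly1 size_polyN geq_max /=.
  by rewrite (leq_trans (size_scale_leq _ _)) // size_polyX.
have h3 (c d : algC) : (size ((1 - 'X * c%:P) * ('X - d%:P) : {poly algC})%R <= 3)%N.
  by apply: leq_trans (size_polyMleq _ _) _; rewrite size_XsubC; have := h2 c; lia.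
have hnu i : (size (num_step w%:P 'X i) <= 3)%N by rewrite /num_step -polyC_exp h3.
have hdel i : (size (den_step w%:P 'X i) <= 3)%N.
  rewrite /den_step -!polyC_exp -![1 + _%:P]polyCD -polyCM mulrC mul_polyC.
  by rewrite (leq_trans (size_scale_leq _ _)) // h3.
rewrite /num; apply: (big_ind (fun p : {poly algC} => (size p <= 2 * M + 1)%N)).
- by rewrite size_poly0.
- by move=> p r hp hr; rewrite (leq_trans (size_polyD _ _)) // geq_max hp.
move=> k _; rewrite /coreN -polyC_exp -(rmorph_qint polyC) -polyC_exp -(rmorph_qbin polyC).
rewrite -polyCM mulrA -polyCM -mulrA mul_polyC (leq_trans (size_scale_leq _ _)) //.
rewrite -(big_mkord xpredT) /=.
have kM : (k <= M)%N by rewrite -ltnS.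
apply: leq_trans (size_polyMleq _ _) _.
rewrite -subn1.
apply: leq_trans (leq_sub2r 1 (leq_add (size_prod_leq2 _ _ hnu) (size_prod_leq2 _ _ hdel))) _.
by rewrite !size_iota; lia.
Qed.

(* By [num_shift], the coefficient of a^i survives only if 2i+1 is a multiple of 2M+1;
   with the degree bound [size_num] this leaves i = M. *)
Lemma num_prim : num w%:P 'X M = 0.
Proof.
pose P : {poly algC} := num w%:P 'X M.
have PE a : P.[a] = num w a M by apply: num_horner.
have Q0 : \poly_(i < size P) (P`_i * (w ^+ (4 * i + 2) - 1)) = 0.
  apply: poly_nat_eq0 => n n1; rewrite horner_poly.
  have := num_shift _ (generic_nat n n1); rewrite -!PE !horner_coef => /eqP.
  rewrite -subr_eq0 mulr_sumr -sumrB => /eqP E; rewrite -[RHS]E; apply: eq_bigr => i _.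
  by rewrite exprMn exprD exprM; ring.
have P_coef i : i != M -> P`_i = 0.
  move=> iM; case: (ltnP i (size P)) => isz; last by rewrite nth_default.
  move/polyP/(_ i): Q0; rewrite coef_poly isz coef0 => /eqP; rewrite mulf_eq0 => /orP[/eqP //|].
  rewrite subr_eq0 prim_expr_eq1 => dv.
  move: dv; have -> : (4 * i + 2 = 2 * (2 * i + 1))%N by lia.
  rewrite Gauss_dvdr ?coprimen2; last lia.
  (* Now 2i+1 = c (2M+1) with i at most 2M, which forces c = 1 and i = M. *)
  move=> /dvdnP[c ec].
  have ii : (i < 2 * M + 1)%N by apply: leq_trans isz size_num.
  have : (c < 2)%N by nia.
  by case: c ec => [|[|c]] // ec _; lia.
have PX : P = P`_M *: 'X^M.
  apply/polyP => i; rewrite coefZ coefXn; have [->|iM] := eqVneq i M; first by rewrite mulr1.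
  by rewrite mulr0 P_coef.
(* At a = w^(4M) = w^(-2) the summands with k < M contain the zero [den_step] of index M-1; for k =
   M the [num_step] of index M-1 vanishes, because w^(4M) = w^(2M-1). *)
have wM : w ^+ (4 * M) = w ^+ (2 * M.-1 + 1).
  have -> : (4 * M = (2 * M + 1) + (2 * M.-1 + 1))%N by lia.
  by rewrite exprD (prim_expr_order w_prim) mul1r.
have : P.[w ^+ (4 * M)] = 0.
  rewrite PE /num big1 // => k _; have kM : (k <= M)%N by rewrite -ltnS.
  have M1 : (M.-1 < M)%N by lia.
  have [ltkM|leMk] := ltnP k M.
    apply/eqP; rewrite mulf_eq0 prodf_seq_eq0; apply/orP; right; apply/hasP; exists M.-1.
      by rewrite mem_index_iota; lia.
    rewrite /= /den_step.
    have -> : (4 * M.-1 + 4 = 4 * M)%N by lia.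
    by rewrite subrr !(mulr0, mul0r) eqxx.
  have -> : nat_of_ord k = M by lia.
  rewrite /coreN (bigD1 (Ordinal M1)) //= /num_step -wM subrr.
  by rewrite !(mulr0, mul0r).
rewrite -/P PX hornerZ hornerXn => /eqP; rewrite mulf_eq0 expf_eq0.
have w0 : w != 0.
  by apply: contra_eq_neq (prim_expr_order w_prim) => ->; rewrite addn1 expr0n eq_sym oner_eq0.
by rewrite expf_eq0 (negbTE w0) !andbF orbF => /eqP ->; rewrite scale0r.
Qed.
End RootOfUnity.

(** * Sums over several periods *)

Section RootOfUnity.
Variables (M : nat) (w a : algC).
Hypotheses (M_gt0 : (0 < M)%N) (w_prim : (2 * M + 1).-primitive_root w).
Hypothesis (ha : forall i, a ^+ i.+1 != 1).

Lemma sum_term_half : \sum_(k < M.+1) term w a k = 0.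
Proof.
have d0 : den w a M != 0.
  by apply/den_neq0 => i _; exact: generic_den_step0 w_prim _ ha _.
by rewrite -num_div // -num_horner num_prim // horner0 mul0r.
Qed.

Lemma sum_term_period n : (M < n)%N -> (n <= 2 * M + 1)%N -> \sum_(k < n) term w a k = 0.
Proof.
move=> Mn nM; rewrite -(subnKC Mn) big_split_ord /= sum_term_half add0r big1 // => i _.
rewrite /term (core_gtM M w M_gt0 w_prim a ha) ?mulr0 //; have := ltn_ord i; lia.
Qed.

(** A block is a multiple of the corresponding sum from k = 0. The last block must be empty or
    contain the whole first half of a period. *)
Lemma sum_term_blocks l n : (n == 0)%N || (M < n)%N && (n <= 2 * M + 1)%N ->
  \sum_(k < l * (2 * M + 1) + n) term w a k = 0.
Proof.
have block l' m : (M < m)%N -> (m <= 2 * M + 1)%N ->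
    \sum_(i < m) term w a (l' * (2 * M + 1) + i) = 0.
  move=> Mm mM; rewrite -[RHS](mulr0 (core w a (l' * (2 * M + 1)))).
  rewrite -[X in _ = _ * X](sum_term_period m) // mulr_sumr; apply: eq_bigr => i _.
  by rewrite (term_block M w M_gt0 w_prim a ha) //; apply: leq_trans (ltn_ord i) mM.
have full : \sum_(k < l * (2 * M + 1)) term w a k = 0.
  elim: l => [|l IH]; first by rewrite big_ord0.
  by rewrite mulSnr big_split_ord /= IH add0r block //; lia.
rewrite big_split_ord /= full add0r.
by case/orP => [/eqP-> | /andP[]]; [rewrite big_ord0 | exact: block].
Qed.
End RootOfUnity.

(** Let z have order 2M+1 and N = c (2M+1) with c = 2l+1. For d = 1 the sum consists of c full
    blocks, for d = 2 of l full blocks and M+1 further terms. *)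
Lemma num_root_of_unity (N d : nat) (z a : algC) :
    odd N -> (d == 1)%N || (d == 2)%N -> z ^+ N = 1 -> z != 1 ->
    (forall i, a ^+ i.+1 != 1) ->
  num z a ((N - 1) %/ d) = 0.
Proof.
move=> oddN hd zN z1 ha.
have N0 : (0 < N)%N by lia.
have [m zm mN] := prim_order_exists N0 zN.
have oddm : odd m by apply: dvdn_odd mN oddN.
have m1 : (1 < m)%N.
  rewrite ltn_neqAle eq_sym (prim_order_gt0 zm) andbT.
  by apply: contra z1 => /eqP e; rewrite -[z]expr1 -e (prim_expr_order zm).
have [M eM] : exists M, m = (2 * M + 1)%N by exists m./2; lia.
have M0 : (0 < M)%N by lia.
rewrite eM in zm mN.
case/dvdnP: mN => c ec.
have [l el] : exists l, c = (2 * l + 1)%N.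
  by exists c./2; move: oddN; rewrite ec oddM => /andP[]; lia.
have dK K : den z a K != 0.
  by apply/den_neq0 => i _; exact: generic_den_step0 zm _ ha _.
have := mulfVK (dK ((N - 1) %/ d)%N) (num z a ((N - 1) %/ d)); rewrite num_div // => <-.
case/orP: hd => /eqP ->.
  have -> : ((N - 1) %/ 1).+1%N = (c * (2 * M + 1) + 0)%N by lia.
  by rewrite (sum_term_blocks M) ?mul0r.
have -> : ((N - 1) %/ 2).+1%N = (l * (2 * M + 1) + M.+1)%N.
  have -> : (N - 1)%N = ((l * (2 * M + 1) + M) * 2)%N by rewrite ec el; nia.
  by rewrite mulnK //; lia.
by rewrite (sum_term_blocks M) ?mul0r //; apply/orP; right; lia.
Qed.

(** * Divisibility and coprimality by evaluation *)

Definition evq (z : algC) (p : {poly rat}) : algC := (map_poly ratr p).[z].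

HB.instance Definition _ (z : algC) :=
  GRing.RMorphism.copy (evq z) (horner_eval z \o map_poly (@ratr algC)).

Definition substq (z : algC) (x : {poly {poly rat}}) : {poly algC} := map_poly (evq z) x.

HB.instance Definition _ (z : algC) := GRing.RMorphism.copy (substq z) (map_poly (evq z)).

Definition ev (z a : algC) (x : {poly {poly rat}}) : algC := (substq z x).[a].

HB.instance Definition _ (z a : algC) :=
  GRing.RMorphism.copy (ev z a) (horner_eval a \o substq z).

Lemma evqE z p : evq z p = (map_poly ratr p).[z].
Proof. by []. Qed.

Lemma evqX z : evq z 'X = z.
Proof. by rewrite evqE map_polyX hornerX. Qed.

Lemma substq_qP z : substq z qP = z%:P.
Proof. by rewrite /substq /= /qP map_polyC /= evqX. Qed.

Lemma substq_aP z : substq z aP = 'X.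
Proof. by rewrite /substq /= /aP map_polyX. Qed.

Lemma evE z a x : ev z a x = (substq z x).[a].
Proof. by []. Qed.

Lemma ev_qP z a : ev z a qP = z.
Proof. by rewrite evE substq_qP hornerC. Qed.

Lemma ev_aP z a : ev z a aP = a.
Proof. by rewrite evE substq_aP hornerX. Qed.

Lemma evq_nat_eq0 (p : {poly rat}) :
  (forall n : nat, (1 < n)%N -> evq n%:R p = 0) -> p = 0.
Proof.
move=> h; apply/eqP; rewrite -(map_poly_eq0 (@ratr algC)); apply/eqP.
by apply: poly_nat_eq0 => n /h.
Qed.

Lemma evq_nat_neq0 (p : {poly rat}) :
  p != 0 -> exists2 n : nat, (1 < n)%N & evq n%:R p != 0.
Proof.
move=> p0; pose s := [seq n%:R : rat | n <- iota 2 (size p)].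
have: ~~ all (root p) s.
  apply: contra p0 => ap; apply/eqP; apply: (@roots_geq_poly_eq0 _ p s) => //.
    by rewrite map_inj_uniq ?iota_uniq // => x y /eqP; rewrite eqr_nat => /eqP.
  by rewrite size_map size_iota.
rewrite -has_predC => /hasP[_ /mapP[n + ->]]; rewrite mem_iota => /andP[n1 _] /= r.
exists n => //; rewrite evqE -[n%:R](ratr_nat algC) horner_map /=.
by rewrite fmorph_eq0.
Qed.

(** A common divisor of positive degree in a has a zero over some q = n at which its leading
    coefficient survives; a nonconstant one in q alone vanishes identically at some complex z. Each
    contradicts one hypothesis. *)
Lemma rel_prime_ev (x y : bipoly) :
    (forall z, substq z x = 0 -> substq z y <> 0) ->
    (forall (n : nat) a, (1 < n)%N -> ev n%:R a x = 0 -> ev n%:R a y <> 0) ->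
  rel_prime x y.
Proof.
move=> hq ha c [e ex] [f fy].
have hz z : substq z c != 0.
  by apply/eqP => c0; apply: (hq z); rewrite ?ex ?fy rmorphM /= c0 mulr0.
have c0 : c != 0 by apply: contra (hz 0) => /eqP->; rewrite rmorph0.
have sc : (size c <= 1)%N.
  rewrite leqNgt; apply/negP => sc.
  have lc0 : lead_coef c != 0 by rewrite lead_coef_eq0.
  have [n n1 ln] := evq_nat_neq0 _ lc0.
  have : size (substq n%:R c) != 1%N.
    by rewrite /substq /= size_map_poly_id0 // gtn_eqF.
  case/closed_rootP => a /eqP ca; apply: (ha n a n1); rewrite ?ex ?fy rmorphM /=.
    by rewrite [ev _ _ c]ca mulr0.
  by rewrite [ev _ _ c]ca mulr0.
have [g cg] : exists g, c = g%:P by exists c`_0; apply: size1_polyC.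
rewrite cg; have g0 : g != 0 by apply: contra c0; rewrite cg => /eqP->; rewrite polyC0.
suff : g \is a GRing.unit by move=> gu; rewrite (rmorph_unit polyC).
rewrite poly_unitE; case: (eqVneq (size g) 1%N) => [sg|sg].
  by move: g0; rewrite unitfE -lead_coef_eq0 lead_coefE sg.
have : size (map_poly (@ratr algC) g) != 1%N by rewrite size_map_poly.
case/closed_rootP => z /eqP gz; have := hz z.
by rewrite cg /substq /= map_polyC /= [evq z g]gz polyC0 eqxx.
Qed.

Lemma pdvd_mull (c x y : bipoly) : pdvd c x -> pdvd c (y * x).
Proof. by move=> [e ->]; exists (y * e); rewrite mulrA. Qed.

Lemma pdvdD (c x y : bipoly) : pdvd c x -> pdvd c y -> pdvd c (x + y).
Proof. by move=> [e ->] [f ->]; exists (e + f); rewrite mulrDl. Qed.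

Lemma pdvd_sum (c : bipoly) I (r : seq I) (F : I -> bipoly) :
  (forall i, pdvd c (F i)) -> pdvd c (\sum_(i <- r) F i).
Proof.
move=> h; apply: (big_ind (pdvd c)) => //; last exact: pdvdD.
by exists 0; rewrite mul0r.
Qed.

(** Since a - q^s is monic in a, the factor theorem applies over Q[q]. *)
Lemma pdvd_sub_qP s (x : bipoly) :
  (forall n : nat, (1 < n)%N -> ev n%:R (n%:R ^+ s) x = 0) -> pdvd (aP - qP ^+ s) x.
Proof.
move=> h; have /factor_theorem[e ex] : root x 'X^s.
  apply/rootP/evq_nat_eq0 => n n1; have := h n n1.
  by rewrite /ev /substq -[in n%:R ^+ s](evqX n%:R) -rmorphXn horner_map.
by exists e; rewrite ex /qP -polyC_exp.
Qed.

(* 1 - a q^s is not monic in a: the reversed polynomial y is evaluated instead, and the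
   resulting power of q is cancelled using 1 = (1 - a q^s) + a q^s. *)
Lemma pdvd_1sub_qP s (x : bipoly) :
  (forall n : nat, (1 < n)%N -> ev n%:R (n%:R ^- s) x = 0) -> pdvd (1 - aP * qP ^+ s) x.
Proof.
move=> h; pose d := size x.
(* This is q^(sd) times the value of [x] at a = q^(-s); as d exceeds the degree in a, no negative
   power of q occurs. *)
pose y : {poly rat} := \sum_(i < d) x`_i * 'X^s ^+ (d - i).
have y0 : y = 0.
  apply: evq_nat_eq0 => n n1; have n0 : (n%:R : algC) != 0 by rewrite pnatr_eq0; lia.
  have := h n n1; rewrite /ev /substq /y rmorph_sum.
  rewrite (@horner_coef_wide _ d) ?size_poly // => E.
  rewrite -[RHS](mulr0 ((n%:R ^+ s) ^+ d)) -[X in _ = _ * X]E mulr_sumr; apply: eq_bigr => i _.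
  rewrite coef_map rmorphM !rmorphXn /= evqX mulrCA; congr (_ * _).
  have lid : (i <= d)%N by apply: ltnW.
  have -> : (n%:R ^+ s : algC) ^+ d = (n%:R ^+ s) ^+ (d - i) * (n%:R ^+ s) ^+ i.
    by rewrite -exprD subnK.
  by rewrite exprVn mulfK ?expf_neq0.
have cancel_q (z : bipoly) : pdvd (1 - aP * qP ^+ s) (qP ^+ s * z) ->
    pdvd (1 - aP * qP ^+ s) z.
  move=> [e ez]; exists (z + aP * e).
  by rewrite [RHS]mulrDl -[aP * e * _]mulrA -ez; ring.
suff : pdvd (1 - aP * qP ^+ s) ((qP ^+ s) ^+ d * x).
  elim: d {y y0} => [|d IH]; first by rewrite mul1r.
  by rewrite exprS -mulrA => /cancel_q.
(* Modulo 1 - a q^s each (a q^s)^i may be replaced by 1, which turns q^(sd) [x] into [y]. *)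
have Ex : (qP ^+ s) ^+ d * x =
    \sum_(i < d) (x`_i * 'X^s ^+ (d - i))%:P * ((aP * qP ^+ s) ^+ i - 1) + y%:P.
  rewrite -{1}[x]coefK poly_def mulr_sumr /y rmorph_sum -big_split; apply: eq_bigr => i _ /=.
  have -> : (qP ^+ s) ^+ d = (qP ^+ s) ^+ (d - i) * (qP ^+ s) ^+ i.
    by rewrite -exprD subnK // ltnW.
  rewrite -mul_polyC polyCM !polyC_exp -/qP exprMn -/aP.
  move: (x`_i)%:P ((qP ^+ s) ^+ (d - i)) ((qP ^+ s) ^+ i) (aP ^+ i) => c u v t.
  by rewrite mulrBr mulr1 subrK mulrACA [u * c]mulrC [v * t]mulrC.
rewrite Ex y0 addr0; apply: pdvd_sum => i; apply: pdvd_mull.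
by exists (- \sum_(j < i) (aP * qP ^+ s) ^+ j); rewrite subrX1; ring.
Qed.

(** As [N] is free of a, each coefficient in Q[q] is treated separately. Over the complex numbers (1
    - q)[N] has the N-th roots of unity as simple roots; the factor 1 - q accounts for the root
    1. *)
Lemma pdvd_qint N (x : bipoly) : (0 < N)%N ->
  (forall z, z ^+ N = 1 -> z != 1 -> substq z x = 0) -> pdvd (qint N qP) x.
Proof.
move=> N0 h.
have Eq : qint N qP = (qint N 'X)%:P by rewrite /qP (rmorph_qint polyC).
have dv i : qint N 'X %| x`_i.
  have [z zp] := C_prim_root_exists N0.
  rewrite -(dvdp_map (@ratr algC)) (rmorph_qint (map_poly (@ratr algC))) /= map_polyX.
  have X1 : 1 - 'X != 0 :> {poly algC}.
    by rewrite -opprB oppr_eq0 -polyC1 polyXsubC_eq0.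
  rewrite -(dvdp_mul2l _ _ X1) qintE -(dvdpNl) opprB -(factor_Xn_sub_1 zp).
  rewrite -(big_map (fun i => z ^+ i) xpredT (fun r => 'X - r%:P)).
  apply: uniq_roots_dvdp.
    apply/allP => _ /mapP[j _ ->]; rewrite rootM.
    have [->|zj] := eqVneq (z ^+ j) 1; first by rewrite /root !hornerE subrr eqxx.
    have zjN : (z ^+ j) ^+ N = 1 by rewrite exprAC (prim_expr_order zp) expr1n.
    have /polyP/(_ i) := h _ zjN zj; rewrite /substq coef_map coef0 => e.
    by apply/orP; right; apply/rootP.
  rewrite uniq_rootsE map_inj_in_uniq ?iota_uniq // => j k.
  rewrite !mem_index_iota => /andP[_ jN] /andP[_ kN] /eqP.
  by rewrite (eq_prim_root_expr zp) !modn_small // => /eqP.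
exists (\poly_(i < size x) (x`_i %/ qint N 'X)).
rewrite Eq; apply/polyP => i; rewrite coefMC coef_poly.
by case: ltnP => isz; [rewrite divpK | rewrite mul0r nth_default].
Qed.

(** The factors are split off one by one: at q = n >= 2 and a = n^(s K) or n^(-s K) the earlier ones
    are nonzero, as [s] is injective and positive, so the quotient vanishes there too. *)
Lemma pdvd_modulus N J (s : nat -> nat) (x : bipoly) :
    (0 < N)%N -> injective s -> (forall j, 0 < s j)%N ->
    (forall z, z ^+ N = 1 -> z != 1 -> substq z x = 0) ->
    (forall (n : nat) j, (1 < n)%N -> (j < J)%N -> ev n%:R (n%:R ^+ s j) x = 0) ->
    (forall (n : nat) j, (1 < n)%N -> (j < J)%N -> ev n%:R (n%:R ^- s j) x = 0) ->
  pdvd (qint N qP *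
    \prod_(j < J) ((1 - aP * qP ^+ s j) * (aP - qP ^+ s j))) x.
Proof.
move=> N0 s_inj s0 hz hp hm.
suff H K : (K <= J)%N -> pdvd (qint N qP *
    \prod_(j < K) ((1 - aP * qP ^+ s j) * (aP - qP ^+ s j))) x by apply: H.
elim: K => [_|K IH KJ]; first by rewrite big_ord0 mulr1; apply: pdvd_qint.
have [e ex] := IH (ltnW KJ).
have nz n : (1 < n)%N -> (n%:R : algC) != 0 by move=> n1; rewrite pnatr_eq0; lia.
have qint_neq0 n : (1 < n)%N -> qint N (n%:R : algC) != 0.
  move=> n1; apply/eqP => q0; have := qintE (n%:R : algC) N.
  rewrite q0 mulr0 => /esym/eqP; rewrite subr_eq0 eq_sym.
  by rewrite (negbTE (expr_neq1 _ (generic_nat n n1) _ N0)).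
have [f ef] : pdvd (aP - qP ^+ s K) e.
  apply: pdvd_sub_qP => n n1; have := hp n K n1 KJ; rewrite ex !rmorphM /=.
  move/eqP; rewrite mulf_eq0 => /orP[/eqP //|]; rewrite mulf_eq0 => /orP[|].
    by rewrite (rmorph_qint (ev _ _)) /= ev_qP (negbTE (qint_neq0 n n1)).
  rewrite rmorph_prod => /prodf_eq0[j _].
  rewrite !(rmorphM, rmorphB, rmorph1, rmorphXn) /= !ev_qP !ev_aP mulf_eq0.
  rewrite -exprD => /orP[|].
    rewrite subr_eq0 eq_sym (negbTE (expr_neq1 _ (generic_nat n n1) _ _)) //.
    by have := s0 K; lia.
  rewrite subr_eq0 (negbTE (expr_neq _ (nz n n1) (generic_nat n n1) _ _ _)) //.
  by rewrite (inj_eq s_inj) gtn_eqF.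
have [g eg] : pdvd (1 - aP * qP ^+ s K) f.
  apply: pdvd_1sub_qP => n n1; have := hm n K n1 KJ; rewrite ex ef !rmorphM /=.
  have sub i j := subV_neq0 _ (nz n n1) (generic_nat n n1) i j.
  move/eqP; rewrite mulf_eq0 => /orP[|].
    rewrite mulf_eq0 => /orP[/eqP //|].
    rewrite rmorphB rmorphXn /= ev_qP ev_aP (negbTE (sub _ _ _)) //.
    by have := s0 K; lia.
  rewrite mulf_eq0 => /orP[|].
    by rewrite (rmorph_qint (ev _ _)) /= ev_qP (negbTE (qint_neq0 n n1)).
  rewrite rmorph_prod => /prodf_eq0[j _].
  rewrite !(rmorphM, rmorphB, rmorph1, rmorphXn) /= !ev_qP !ev_aP mulf_eq0 => /orP[|].
    rewrite subr_eq0 -(inj_eq (mulfI (expf_neq0 (s K) (nz n n1)))) mulr1 mulVKf ?expf_neq0 ?nz //.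
    rewrite (negbTE (expr_neq _ (nz n n1) (generic_nat n n1) _ _ _)) //.
    by rewrite (inj_eq s_inj) gtn_eqF.
  by rewrite (negbTE (sub _ _ _)) //; have := s0 K; lia.
by exists g; rewrite big_ord_recr /= ex ef eg; ring.
Qed.

(** * The congruence *)

(** Apart from [6k+1], both sides are 1 at k = 0 and have the same ratio by [coreS]. *)
Lemma term_qpoch {F : fieldType} (q a : F) k :
    a != 0 -> (forall i, (i < k)%N -> 1 - q ^+ (4 * i + 4) != 0) ->
    (forall i, (i < k)%N -> den_step q a i != 0) ->
  q ^+ (k ^ 2) * qint (6 * k + 1) q
    * (qpoch (a * q) (q ^+ 2) k * qpoch (q / a) (q ^+ 2) k * qpoch (q ^+ 2) (q ^+ 4) k)
    / (qpoch (a * q ^+ 4) (q ^+ 4) k * qpoch (q ^+ 4 / a) (q ^+ 4) k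
       * qpoch (q ^+ 4) (q ^+ 4) k)
  = term q a k.
Proof.
move=> a0 hq hd; rewrite /term [_ * qint _ _]mulrC -2!(mulrA (qint _ _)); congr (_ * _).
elim: k hq hd => [|k IH] hq hd.
  by rewrite core0 /qpoch !big_ord0 !mulr1 invr1 mulr1.
have {}IH := IH (fun i l => hq i (leqW l)) (fun i l => hd i (leqW l)).
have := coreS _ _ _ (hd k (leqnn _)); have qk := hq k (leqnn _).
have := hd k (leqnn _); rewrite /den_step !mulf_eq0 !negb_or -!andbA => /and4P[d1 d2 _ _].
have -> : (k.+1 ^ 2 = k ^ 2 + (2 * k + 1))%N by lia.
rewrite /qpoch !big_ord_recr /= -IH -!exprM /num_step.
rewrite -![\prod_(i < k) _]/(qpoch _ _ k).
move: (qpoch (a * q) _ k) (qpoch (q / a) _ k) (qpoch (q ^+ 2) _ k)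
  (qpoch (a * q ^+ 4) _ k) (qpoch (q ^+ 4 / a) _ k) (qpoch (q ^+ 4) _ k) => A B C D E G.
have e m c : q ^+ (m * k + c) = q ^+ (m * k) * q ^+ c by rewrite exprD.
rewrite (exprD _ (k ^ 2)) !e in qk d1 d2 *.
move: (q ^+ (k ^ 2)) (q ^+ (2 * k)) (q ^+ (4 * k)) qk d1 d2 => z x y qk d1 d2 H.
apply: (mulfI (_ : (1 - y * q ^+ 4) * ((1 - a * (y * q ^+ 4)) * (a - y * q ^+ 4)) != 0)).
  by rewrite !mulf_neq0.
(* The old inverse is kept as one atom, so that only the new factors must be nonzero. *)
rewrite H; set iDEG := (D * E * G)^-1.
have d2' : 1 - q ^+ 4 / a * y != 0.
  have -> : 1 - q ^+ 4 / a * y = (a - y * q ^+ 4) / a by field.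
  by rewrite mulf_neq0 ?invr_eq0.
have -> : (D * (1 - a * q ^+ 4 * y) * (E * (1 - q ^+ 4 / a * y)) * (G * (1 - q ^+ 4 * y)))^-1
   = iDEG / ((1 - a * (y * q ^+ 4)) * (1 - q ^+ 4 / a * y) * (1 - y * q ^+ 4)).
  by rewrite -invfM; congr (_^-1); ring.
by field; rewrite a0 qk [q ^+ 4 * y]mulrC d2 d1.
Qed.

Section NotRootOfUnity.
Context {F : fieldType} (q : F).
Hypotheses (q0 : q != 0) (hq : forall i, q ^+ i.+1 != 1).

Lemma den_odd_neg_neq0 J K : den q (q ^- (2 * J + 1)) K != 0.
Proof. by apply/den_neq0 => i _; apply: den_step_odd_neq0. Qed.

Lemma den_odd_pos_neq0 J K : den q (q ^+ (2 * J + 1)) K != 0.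
Proof.
apply/den_neq0 => i _; rewrite -[_ ^+ _]invrK den_step_invr ?invr_eq0 ?expf_neq0 //.
by rewrite mulf_neq0 ?den_step_odd_neq0 // invr_eq0 expf_neq0 // invr_eq0 expf_neq0.
Qed.

Lemma num_odd_neg J K : (J <= K)%N ->
  num q (q ^- (2 * J + 1)) K =
  den q (q ^- (2 * J + 1)) K * ((- q) ^- J * qint (2 * J + 1) q).
Proof.
move=> JK; rewrite -(sum_term_odd _ q0 hq J K.+1) // -num_div ?den_odd_neg_neq0 //.
by rewrite mulrC mulfVK // den_odd_neg_neq0.
Qed.

Lemma num_odd_pos J K : (J <= K)%N ->
  num q (q ^+ (2 * J + 1)) K =
  den q (q ^+ (2 * J + 1)) K * ((- q) ^- J * qint (2 * J + 1) q).
Proof.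
move=> JK; rewrite -(sum_term_odd _ q0 hq J K.+1) //.
under eq_bigr do rewrite term_invr ?expf_neq0 //.
by rewrite -num_div ?den_odd_pos_neq0 // mulrC mulfVK // den_odd_pos_neq0.
Qed.

End NotRootOfUnity.

Lemma qint_mul {F : fieldType} (q : F) m n : q != 1 ->
  qint (m * n) q = qint n q * qint m (q ^+ n).
Proof.
move=> q1; apply: (@mulfI _ (1 - q)); first by rewrite subr_eq0 eq_sym.
by rewrite mulrA !qintE mulnC exprM.
Qed.

(** With c = (n-1)/2, [diffN] over [diffD] is the difference of the two sides; multiplying by (-q)^c
    clears the negative power of q. *)
Definition diffN (c n K K' : nat) : bipoly :=
  (- qP) ^+ c * num qP aP K * den (qP ^+ n) aP K'
  - qint n qP * num (qP ^+ n) aP K' * den qP aP K.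

Definition diffD (c n K K' : nat) : bipoly :=
  (- qP) ^+ c * den qP aP K * den (qP ^+ n) aP K'.

Lemma ev_diffN z a c n K K' : ev z a (diffN c n K K') =
  (- z) ^+ c * num z a K * den (z ^+ n) a K' - qint n z * num (z ^+ n) a K' * den z a K.
Proof.
rewrite /diffN rmorphB !rmorphM rmorphXn rmorphN /=.
rewrite (rmorph_qint (ev z a)) !(rmorph_num (ev z a)) !(rmorph_den (ev z a)) /=.
by rewrite !rmorphXn /= ev_qP ev_aP.
Qed.

Lemma ev_diffD z a c n K K' : ev z a (diffD c n K K') =
  (- z) ^+ c * den z a K * den (z ^+ n) a K'.
Proof.
rewrite /diffD !rmorphM rmorphXn rmorphN /= !(rmorph_den (ev z a)) /=.
by rewrite !rmorphXn /= ev_qP ev_aP.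
Qed.

Lemma substq_diffD z c n K K' : substq z (diffD c n K K') =
  (- z%:P) ^+ c * den z%:P 'X K * den (z%:P ^+ n) 'X K'.
Proof.
rewrite /diffD !rmorphM rmorphXn rmorphN /= !(rmorph_den (substq z)) /=.
by rewrite !rmorphXn /= substq_qP substq_aP.
Qed.

Lemma expn_neq1 {F : fieldType} (q : F) n : (0 < n)%N -> (forall i, q ^+ i.+1 != 1) ->
  forall i, (q ^+ n) ^+ i.+1 != 1.
Proof. by move=> n0 hq i; rewrite -exprM expr_neq1 //; lia. Qed.

Lemma half_odd_mul n j : odd n ->
  ((2 * j + 1) * n = 2 * ((n - 1) %/ 2 + n * j) + 1)%N.
Proof. by move=> oddn; nia. Qed.

(** Ensures that the left sum contains every nonzero term at a = q^(-(2j+1)n), for each j occurring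
    in the modulus. *)
Lemma half_bound n m d j : odd n -> odd m -> (d == 1)%N || (d == 2)%N ->
  (j < ((m - 1) %/ d).+1)%N -> ((n - 1) %/ 2 + n * j <= (n * m - 1) %/ d)%N.
Proof.
move=> on om /orP[] /eqP -> jm.
  have {}jm : (j.+1 <= m)%N by move: jm; rewrite divn1; lia.
  have : (n * j.+1 <= n * m)%N by rewrite leq_mul2l jm orbT.
  by rewrite divn1 mulnS; lia.
have {}jm : (2 * j + 1 <= m)%N by lia.
rewrite leq_divRL //.
have h : (n * (2 * j + 1) <= n * m)%N by rewrite leq_mul2l jm orbT.
have := half_odd_mul n j on; rewrite mulnC; move: h; lia.
Qed.

(** * Values of the numerator and denominator of the difference *)

Section Evaluation.
Variables (n m d : nat).
Hypotheses (n_odd : odd n) (m_odd : odd m) (hd : (d == 1)%N || (d == 2)%N).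
Let c := ((n - 1) %/ 2)%N.
Let K := ((n * m - 1) %/ d)%N.
Let K' := ((m - 1) %/ d)%N.
Let nP : bipoly := diffN c n K K'.
Let dP : bipoly := diffD c n K K'.

Let n_gt0 : (0 < n)%N. Proof. by case: n n_odd. Qed.
Let m_gt0 : (0 < m)%N. Proof. by case: m m_odd. Qed.

(** The left numerator vanishes at z. On the right either z^n = 1 and [n] = 0, or z^n is an m-th
    root of unity other than 1 and the shorter sum vanishes. *)
Lemma substq_diffN_unity z : z ^+ (n * m) = 1 -> z != 1 -> substq z nP = 0.
Proof.
move=> zN z1; apply: poly_nat_eq0 => i i1.
rewrite -[LHS]/(ev z i%:R nP) ev_diffN.
have gi := generic_nat i i1.
rewrite num_root_of_unity ?oddM ?n_odd //.
have [zn1|zn1] := eqVneq (z ^+ n) 1.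
  suff -> : qint n z = 0 by rewrite !(mulr0, mul0r) subrr.
  apply/eqP; have /eqP := qintE z n.
  by rewrite zn1 subrr mulf_eq0 subr_eq0 eq_sym (negbTE z1).
by rewrite (num_root_of_unity m) -?exprM // !(mulr0, mul0r) subrr.
Qed.

Section NotRootOfUnity.
Variable q : algC.
Hypotheses (q0 : q != 0) (hq : forall i, q ^+ i.+1 != 1).

Let qn0 : q ^+ n != 0. Proof. exact: expf_neq0. Qed.
Let hqn := expn_neq1 q n n_gt0 hq.

(** Uses [(2j+1)n] = [n] [2j+1]_(q^n) and, for odd n, (-q)^(nj) = (-q^n)^j. *)
Lemma qint_shift j :
  (- q) ^+ c * ((- q) ^- (c + n * j) * qint (2 * (c + n * j) + 1) q) =
  qint n q * ((- q ^+ n) ^- j * qint (2 * j + 1) (q ^+ n)).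
Proof.
have q1 : q != 1 by rewrite -[q]expr1.
rewrite -half_odd_mul // (qint_mul q) //.
have qn : - q ^+ n = (- q) ^+ n by rewrite (exprNn q) -signr_odd n_odd expr1 mulN1r.
rewrite qn -exprM exprD invfM -!mulrA mulVKf ?expf_neq0 ?oppr_eq0 //.
by rewrite mulrCA.
Qed.

(** The same a is an odd negative power of q and of q^n, so both sums have closed forms, which
    [qint_shift] equates. *)
Lemma ev_diffN_expV j : (j < K'.+1)%N -> ev q (q ^- ((2 * j + 1) * n)) nP = 0.
Proof.
move=> jK; rewrite ev_diffN; set a := q ^- _.
have -> : num q a K = den q a K * ((- q) ^- (c + n * j) * qint (2 * (c + n * j) + 1) q).
  by rewrite /a half_odd_mul // num_odd_neg //; apply: half_bound.
have -> : num (q ^+ n) a K' =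
    den (q ^+ n) a K' * ((- q ^+ n) ^- j * qint (2 * j + 1) (q ^+ n)).
  by rewrite /a mulnC exprM num_odd_neg.
rewrite [_ ^+ c * _]mulrCA qint_shift.
by apply/eqP; rewrite subr_eq0; apply/eqP; ring.
Qed.

Lemma ev_diffN_exp j : (j < K'.+1)%N -> ev q (q ^+ ((2 * j + 1) * n)) nP = 0.
Proof.
move=> jK; rewrite ev_diffN; set a := q ^+ _.
have -> : num q a K = den q a K * ((- q) ^- (c + n * j) * qint (2 * (c + n * j) + 1) q).
  by rewrite /a half_odd_mul // num_odd_pos //; apply: half_bound.
have -> : num (q ^+ n) a K' =
    den (q ^+ n) a K' * ((- q ^+ n) ^- j * qint (2 * j + 1) (q ^+ n)).
  by rewrite /a mulnC exprM num_odd_pos.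
rewrite [_ ^+ c * _]mulrCA qint_shift.
by apply/eqP; rewrite subr_eq0; apply/eqP; ring.
Qed.

Lemma ev_diffD_expV j : ev q (q ^- ((2 * j + 1) * n)) dP != 0.
Proof.
rewrite ev_diffD !mulf_neq0 ?expf_neq0 ?oppr_eq0 //.
  by rewrite half_odd_mul // den_odd_neg_neq0.
by rewrite mulnC exprM den_odd_neg_neq0.
Qed.

Lemma ev_diffD_exp j : ev q (q ^+ ((2 * j + 1) * n)) dP != 0.
Proof.
rewrite ev_diffD !mulf_neq0 ?expf_neq0 ?oppr_eq0 //.
  by rewrite half_odd_mul // den_odd_pos_neq0.
by rewrite mulnC exprM den_odd_pos_neq0.
Qed.
End NotRootOfUnity.

(** With a indeterminate, the factors containing a are nonzero polynomials, and the factors 1 +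
    q^(2i) are nonzero at roots of unity of odd order. *)
Lemma substq_diffD_unity z : z ^+ (n * m) = 1 -> substq z dP != 0.
Proof.
move=> zN; have N0 : (0 < n * m)%N by rewrite muln_gt0 n_gt0.
have oN : odd (n * m) by rewrite oddM n_odd.
have z0 : z != 0.
  by apply: contra_eq_neq zN => ->; rewrite expr0n gtn_eqF // eq_sym oner_eq0.
have del0 l i : den_step (z%:P ^+ l) 'X i != 0 :> {poly algC}.
  rewrite /den_step -!exprM -!polyC_exp !mulf_neq0 ?polyXsubC_eq0 //.
  - apply/eqP => /(congr1 (fun p => p.[0])); rewrite !hornerE ?mul0r ?subr0 => /eqP.
    by rewrite oner_eq0.
  - by rewrite -polyCD polyC_eq0 (unity_addr1_neq0 (n * m)).
  - by rewrite -polyCD polyC_eq0 (unity_addr1_neq0 (n * m)).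
have den0 l L : den (z%:P ^+ l) 'X L != 0 :> {poly algC}.
  by rewrite /den; apply/prodf_neq0.
by rewrite substq_diffD !mulf_neq0 ?expf_neq0 ?oppr_eq0 ?polyC_eq0 // -[z%:P]expr1.
Qed.

Let P : bipoly := qint (n * m) qP *
  \prod_(j < K'.+1) ((1 - aP * qP ^+ ((2 * j + 1) * n)) * (aP - qP ^+ ((2 * j + 1) * n))).

Lemma pdvd_diffN : pdvd P nP.
Proof.
apply: (pdvd_modulus (n * m) K'.+1 (fun j => (2 * j + 1) * n)%N).
- by rewrite muln_gt0 n_gt0.
- by move=> i j /eqP; rewrite eqn_pmul2r // => /eqP; lia.
- by move=> j; rewrite muln_gt0 n_gt0 andbT; lia.
- exact: substq_diffN_unity.
- move=> i j i1 jK; apply: ev_diffN_exp => //; last exact: generic_nat.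
  by rewrite pnatr_eq0; lia.
- move=> i j i1 jK; apply: ev_diffN_expV => //; last exact: generic_nat.
  by rewrite pnatr_eq0; lia.
Qed.

(** The modulus vanishes identically in a only at roots of unity, and over q = i >= 2 only at a =
    i^((2j+1)n) or its inverse; [diffD] is nonzero at all of these. *)
Lemma rel_prime_diffD : rel_prime dP P.
Proof.
have N0 : (0 < n * m)%N by rewrite muln_gt0 n_gt0.
apply: rel_prime_ev => [z d0|i a i1 d0].
  rewrite /P rmorphM /= (rmorph_qint (substq z)) /= substq_qP rmorph_prod => /eqP.
  rewrite mulf_eq0 => /orP[|/prodf_eq0[j _]]; last first.
    rewrite !(rmorphM, rmorphB, rmorph1, rmorphXn) /= substq_qP substq_aP -polyC_exp mulf_eq0.
    rewrite polyXsubC_eq0 orbF => /eqP/(congr1 (fun p => p.[0])).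
    by rewrite !hornerE ?mul0r ?subr0 => /eqP; rewrite oner_eq0.
  rewrite -(rmorph_qint polyC) polyC_eq0 => /eqP q0.
  have := qintE z (n * m); rewrite q0 mulr0 => /esym/eqP; rewrite subr_eq0 => /eqP zN.
  by have := substq_diffD_unity z (esym zN); rewrite d0 eqxx.
have i0 : (i%:R : algC) != 0 by rewrite pnatr_eq0; lia.
have gi := generic_nat i i1.
rewrite /P rmorphM /= (rmorph_qint (ev _ _)) /= ev_qP rmorph_prod => /eqP.
rewrite mulf_eq0 => /orP[/eqP q0|/prodf_eq0[j _]].
  have := qintE (i%:R : algC) (n * m); rewrite q0 mulr0 => /esym/eqP.
  by rewrite subr_eq0 eq_sym (negbTE (expr_neq1 _ gi _ N0)).
rewrite !(rmorphM, rmorphB, rmorph1, rmorphXn) /= ev_qP ev_aP mulf_eq0 !subr_eq0.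
have u0 : (i%:R : algC) ^+ ((2 * j + 1) * n) != 0 by rewrite expf_neq0.
case/orP => /eqP e.
  have ea : a = i%:R ^- ((2 * j + 1) * n).
    by apply: (mulIf u0); rewrite -e mulVf.
  by have := ev_diffD_expV _ i0 gi j; rewrite -ea d0 eqxx.
by have := ev_diffD_exp _ i0 gi j; rewrite -e d0 eqxx.
Qed.

End Evaluation.

(** * Passage to the field of rational functions *)

Lemma sub_divf {F : fieldType} (u x nL dL nR dR : F) :
    u != 0 -> dL != 0 -> dR != 0 ->
  nL / dL - u^-1 * x * (nR / dR) = (u * nL * dR - x * nR * dL) / (u * dL * dR).
Proof. by move=> u0 l0 r0; field; rewrite u0 l0 r0. Qed.

Lemma tofr_neq0 (p : bipoly) : p != 0 -> tofr p != 0.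
Proof. by rewrite /tofr tofrac_eq0. Qed.

Lemma qP_neq0 : qP != 0.
Proof. by rewrite /qP polyC_eq0 polyX_eq0. Qed.

Lemma aP_neq0 : aP != 0.
Proof. by rewrite /aP polyX_eq0. Qed.

(** Taken with m = 1 for the left sum and m = n for the right one. Denominators are nonzero because
    they are so at q = 2, a = 2^m. *)
Lemma sum_qpoch (m K : nat) : (0 < m)%N ->
  \sum_(k < K.+1)
     (qF ^+ m) ^+ (k ^ 2) * qint (6 * k + 1) (qF ^+ m)
     * (qpoch (aF * qF ^+ m) ((qF ^+ m) ^+ 2) k * qpoch (qF ^+ m / aF) ((qF ^+ m) ^+ 2) k
        * qpoch ((qF ^+ m) ^+ 2) ((qF ^+ m) ^+ 4) k)
     / (qpoch (aF * (qF ^+ m) ^+ 4) ((qF ^+ m) ^+ 4) k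
        * qpoch ((qF ^+ m) ^+ 4 / aF) ((qF ^+ m) ^+ 4) k
        * qpoch ((qF ^+ m) ^+ 4) ((qF ^+ m) ^+ 4) k)
  = tofr (num (qP ^+ m) aP K) / tofr (den (qP ^+ m) aP K)
  /\ tofr (den (qP ^+ m) aP K) != 0.
Proof.
move=> m0.
have q2 : (2%:R : algC) ^+ m != 0 by rewrite expf_neq0 // pnatr_eq0.
have h2 := expn_neq1 (2%:R : algC) m m0 (generic_nat 2 isT).
have ev2 : ev 2%:R (2%:R ^+ m) (qP ^+ m) = 2%:R ^+ m by rewrite rmorphXn /= ev_qP.
have del0 i : tofr (den_step (qP ^+ m) aP i) != 0.
  apply: tofr_neq0; apply/eqP => /(congr1 (ev 2%:R (2%:R ^+ m))).
  rewrite (rmorph_den_step (ev _ _)) rmorph0 /= ev2 ev_aP => /eqP.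
  have /den_neq0/(_ i (leqnn _)) := den_odd_pos_neq0 _ q2 h2 0 i.+1.
  by rewrite expr1 => /negbTE ->.
have qm0 i : tofr (1 - (qP ^+ m) ^+ (4 * i + 4)) != 0.
  apply: tofr_neq0; apply/eqP => /(congr1 (ev 2%:R (2%:R ^+ m))).
  rewrite rmorphB rmorph1 rmorphXn rmorph0 /= ev2 => /eqP.
  rewrite subr_eq0 eq_sym (negbTE (expr_neq1 _ h2 _ _)) //; lia.
have dE K' : tofr (den (qP ^+ m) aP K') = den (qF ^+ m) aF K'.
  by rewrite /tofr (rmorph_den (@FracField.tofrac bipoly)) rmorphXn.
have nE : tofr (num (qP ^+ m) aP K) = num (qF ^+ m) aF K.
  by rewrite /tofr (rmorph_num (@FracField.tofrac bipoly)) rmorphXn.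
have delE i : tofr (den_step (qP ^+ m) aP i) = den_step (qF ^+ m) aF i.
  by rewrite /tofr (rmorph_den_step (@FracField.tofrac bipoly)) rmorphXn.
have d0 : tofr (den (qP ^+ m) aP K) != 0.
  by rewrite dE; apply/den_neq0 => i _; rewrite -delE.
split=> //; rewrite dE nE num_div -?dE //.
apply: eq_bigr => k _; apply: term_qpoch.
- exact: tofr_neq0 aP_neq0.
- move=> i _; have := qm0 i.
  by rewrite /tofr rmorphB rmorph1 !rmorphXn.
- by move=> i _; rewrite -delE; exact: del0.
Qed.

Theorem theorem3p2 (n r d : nat) (n_odd : odd n) (n_gt1 : (1 < n)%N)
    (r_ge1 : (1 <= r)%N) (hd : (d == 1)%N || (d == 2)%N) :
  qcong
    (\sum_(k < ((n ^ r - 1) %/ d).+1)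
       qF ^+ (k ^ 2) * qint (6 * k + 1) qF
       * (qpoch (aF * qF) (qF ^+ 2) k * qpoch (qF / aF) (qF ^+ 2) k
          * qpoch (qF ^+ 2) (qF ^+ 4) k)
       / (qpoch (aF * qF ^+ 4) (qF ^+ 4) k * qpoch (qF ^+ 4 / aF) (qF ^+ 4) k
          * qpoch (qF ^+ 4) (qF ^+ 4) k))
    ((- qF) ^- ((n - 1) %/ 2) * qint n qF *
     \sum_(k < ((n ^ r.-1 - 1) %/ d).+1)
       qF ^+ (n * k ^ 2) * qint (6 * k + 1) (qF ^+ n)
       * (qpoch (aF * qF ^+ n) (qF ^+ (2 * n)) k
          * qpoch (qF ^+ n / aF) (qF ^+ (2 * n)) k
          * qpoch (qF ^+ (2 * n)) (qF ^+ (4 * n)) k)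
       / (qpoch (aF * qF ^+ (4 * n)) (qF ^+ (4 * n)) k
          * qpoch (qF ^+ (4 * n) / aF) (qF ^+ (4 * n)) k
          * qpoch (qF ^+ (4 * n)) (qF ^+ (4 * n)) k))
    (qint (n ^ r) qP *
     \prod_(j < ((n ^ r.-1 - 1) %/ d).+1)
       ((1 - aP * qP ^+ ((2 * j + 1) * n)) * (aP - qP ^+ ((2 * j + 1) * n)))).
Proof.
have n0 : (0 < n)%N by lia.
have odd_m : odd (n ^ r.-1) by rewrite oddX n_odd orbT.
have -> : (n ^ r = n * n ^ r.-1)%N by rewrite -expnS prednK.
(* From here on n^(r-1) is an arbitrary odd m. *)
move: (n ^ r.-1)%N odd_m => m odd_m.
set c := ((n - 1) %/ 2)%N; set K := ((n * m - 1) %/ d)%N; set K' := ((m - 1) %/ d)%N.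
exists (diffN c n K K'), (diffD c n K K').
have [EL dL] := sum_qpoch 1 K isT.
have [ER dR] := sum_qpoch n K' n0.
rewrite !expr1 in EL dL.
rewrite -(exprM qF n 2) -(exprM qF n 4) in ER.
have {}ER : \sum_(k < K'.+1)
       qF ^+ (n * k ^ 2) * qint (6 * k + 1) (qF ^+ n)
       * (qpoch (aF * qF ^+ n) (qF ^+ (n * 2)) k
          * qpoch (qF ^+ n / aF) (qF ^+ (n * 2)) k
          * qpoch (qF ^+ (n * 2)) (qF ^+ (n * 4)) k)
       / (qpoch (aF * qF ^+ (n * 4)) (qF ^+ (n * 4)) k
          * qpoch (qF ^+ (n * 4) / aF) (qF ^+ (n * 4)) k
          * qpoch (qF ^+ (n * 4)) (qF ^+ (n * 4)) k)
    = tofr (num (qP ^+ n) aP K') / tofr (den (qP ^+ n) aP K').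
  by rewrite -ER; apply: eq_bigr => k _; rewrite (exprM qF n (k ^ 2)).
rewrite (mulnC 2 n) (mulnC 4 n) EL ER.
have u0 : (- qF) ^+ c != 0.
  by apply: expf_neq0; rewrite oppr_eq0; exact: tofr_neq0 qP_neq0.
have qE : tofr ((- qP) ^+ c) = (- qF) ^+ c by rewrite /tofr rmorphXn rmorphN.
have iE : tofr (qint n qP) = qint n qF by rewrite /tofr (rmorph_qint (@FracField.tofrac bipoly)).
have DE : tofr (diffD c n K K') =
    (- qF) ^+ c * tofr (den qP aP K) * tofr (den (qP ^+ n) aP K').
  by rewrite -qE /tofr -!rmorphM.
have NE : tofr (diffN c n K K') =
    (- qF) ^+ c * tofr (num qP aP K) * tofr (den (qP ^+ n) aP K')
    - qint n qF * tofr (num (qP ^+ n) aP K') * tofr (den qP aP K).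
  by rewrite -qE -iE /tofr -!rmorphM -rmorphB.
split; [|split; [|split]].
- have : tofr (diffD c n K K') != 0.
    rewrite DE; apply: mulf_neq0; last exact: dR.
    by apply: mulf_neq0; [exact: u0 | exact: dL].
  apply: contra => /eqP ->.
  rewrite /tofr rmorph0.
  exact: eqxx.
- rewrite NE DE; apply: sub_divf; [exact: u0 | exact: dL | exact: dR].
- exact: pdvd_diffN.
- exact: rel_prime_diffD.
Qed.
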